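(* Let $\bm n\in\mathbb N^r$ and let $\bm\alpha=(\alpha_1,\dots,\alpha_r)$ satisfy $\alpha_1,\dots,\alpha_r>-1$ and $\alpha_i-\alpha_j\notin\mathbb Z$ for $i\neq j$. For each $i\in\{1,\dots,r\}$ and each $0\le t\le2$ such that $\alpha_i-\alpha_j+t\notin\mathbb Z$ for all $j\neq i$, the Type II multiple Laguerre polynomials of the first kind satisfy the interlacing $$L^{(\bm\alpha)}_{\bm n+\bm e_i}\preccurlyeq L^{(\bm\alpha)}_{\bm n}\preccurlyeq L^{(\bm\alpha+t\bm e_i)}_{\bm n},$$ where $\bm e_i$ is the multi-index whose only nonzero entry (equal to $1$) is in position $i$.
   Context: $\mathbb N=\{1,2,\dots\}$, $|\bm n|=n_1+\dots+n_r$. Type II multiple Laguerre polynomial of the first kind $L^{(\bm\alpha)}_{\bm n}$: the monic polynomial of degree $|\bm n|$ with $\int_0^\infty L^{(\bm\alpha)}_{\bm n}(x)x^{\alpha_j+k}e^{-x}dx=0$ for $k=0,1,\dots,n_j-1$, $j=1,\dots,r$. Interlacing: let $p$ be real-rooted of degree $N$ with zeros $\lambda_1(p)\le\dots\le\lambda_N(p)$ and $q$ real-rooted of degree $M$ with zeros $\lambda_1(q)\le\dots\le\lambda_M(q)$. Then $p\preccurlyeq q$ means that either $M=N$ and $\lambda_1(p)\le\lambda_1(q)\le\lambda_2(p)\le\lambda_2(q)\le\dots\le\lambda_N(p)\le\lambda_N(q)$, or $M=N-1$ and $\lambda_1(p)\le\lambda_1(q)\le\lambda_2(p)\le\dots\le\lambda_{N-1}(p)\le\lambda_{N-1}(q)\le\lambda_N(p)$.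 *)

(* Defs.v *)
From HB Require Import structures.
From mathcomp Require Import all_boot all_order all_algebra.
From mathcomp Require Import all_classical all_reals all_analysis.
Set Implicit Arguments.
Unset Strict Implicit.
Unset Printing Implicit Defensive.
Import Order.TTheory GRing.Theory Num.Theory.
Import numFieldNormedType.Exports.
Local Open Scope classical_set_scope.
Local Open Scope ring_scope.

Definition is_mlaguerre (R : realType) (r : nat) (alpha : 'I_r -> R)
    (n : 'I_r -> nat) (p : {poly R}) : Prop :=
  [/\ p \is monic,
      size p = (\sum_(j < r) n j)%N.+1 &
      forall (j : 'I_r) (k : nat), (k < n j)%N ->
        (\int[lebesgue_measure]_(x in `]0%R, +oo[)
           (p.[x] * x `^ (alpha j + k%:R) * expR (- x))%R%:E = 0)%E].

(* "The" polynomial characterized by [is_mlaguerre]; the default value 0, which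
   does not satisfy [is_mlaguerre], is only used when no such polynomial
   exists. *)
Definition mlaguerre (R : realType) (r : nat) (alpha : 'I_r -> R)
    (n : 'I_r -> nat) : {poly R} :=
  xget 0 [set p | is_mlaguerre alpha n p].

(* [s] lists the zeros of [p], with multiplicity, in nondecreasing order; the
   existence of such an [s] means that [p] is a nonzero real-rooted
   polynomial, whose degree is then [size s]. *)
Definition zeros_of (R : realType) (p : {poly R}) (s : seq R) : Prop :=
  [/\ p != 0, sorted <=%R s &
      p = lead_coef p *: \prod_(z <- s) ('X - z%:P)].

(* Indices are shifted by one: s`_k is the (k+1)-st zero. *)
Definition interlaces (R : realType) (p q : {poly R}) : Prop :=
  exists s u : seq R, [/\ zeros_of p s, zeros_of q u &
    [/\ size u = size s,
        forall k, (k < size s)%N -> s`_k <= u`_k &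
        forall k, (k.+1 < size s)%N -> u`_k <= s`_k.+1]
    \/
    ((size u).+1 = size s /\
     forall k, (k < size u)%N -> s`_k <= u`_k <= s`_k.+1)].

Notation "p ≼ q" := (interlaces p q) (at level 70, no associativity).

Definition add_e (V : nmodType) (r : nat) (a : 'I_r -> V) (i : 'I_r) (c : V) :
    'I_r -> V :=
  fun j => if j == i then a j + c else a j.

(* Main.v *)
(* For [M_b p = (x - 1 - b) p - x p'] one has [\int (M_b p) x^s e^{-x} =
   (s - b) \int p x^s e^{-x}], so the multiple Laguerre polynomial is obtained
   from [1] by applying, in any order, the commuting operators [M_b] for
   [b = alpha_j + k], [k < n_j]. By Rolle's theorem [M_b p] is interlaced by [p]
   if [b > -1] and [p] has simple positive zeros, which is the first interlacing.
   Moreover the zeros of [M_b p] increase with [b], since [M_{b+c} p = M_b p - c p],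
   so all zeros increase with [alpha_i]; hence the second interlacing follows
   from the case [t = 2]. The operators [M_b] preserve strict interlacing, which
   reduces that case to a classical Laguerre polynomial [p] with parameter [a].
   There the shifted polynomial is [p - 2 p' + p''] and, by the Laguerre
   differential equation, its value at a zero [z] of [p] is
   [- (1 + (a + 1) / z) p'(z)]. *)

Require Import Defs.
From HB Require Import structures.
From mathcomp Require Import all_boot all_order all_algebra.
From mathcomp Require Import all_classical all_reals all_analysis.
From mathcomp Require Import measurable_realfun ring lra zify.
From mathcomp Require polyrcf.
Set Implicit Arguments.
Unset Strict Implicit.
Unset Printing Implicit Defensive.
Import Order.TTheory GRing.Theory Num.Theory.
Import numFieldNormedType.Exports.
Local Open Scope classical_set_scope.
Local Open Scope ring_scope.

(** * Interlacing of zeros *)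

Section Interlacing.
Variable R : rcfType.
Implicit Types (s u v : nat -> R) (p q : {poly R}) (N : nat).

(** Zeros are indexed by total functions on [nat], of which only the values below [N] matter. *)
Definition rootpoly N s : {poly R} := \prod_(i < N) ('X - (s i)%:P).

Definition increasing_upto N s := forall i j, (i < j < N)%N -> s i < s j.

(** Strict interlacing in equal degree. Strictness keeps the zeros simple, so that the relation can
    be read off from signs at the zeros. *)
Definition laced N s u :=
  (forall k, (k < N)%N -> s k < u k) /\
  (forall k, (k.+1 < N)%N -> u k < s k.+1).

Lemma size_monicB p q N : p \is monic -> q \is monic ->
  size p = N.+1 -> size q = N.+1 -> (size (p - q)%R <= N)%N.
Proof.
move=> /monicP pm /monicP qm sp sq; apply/leq_sizeP => j.
rewrite leq_eqVlt coefB => /predU1P[<-|Nj].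
  by move: pm qm; rewrite /lead_coef sp sq => -> ->; rewrite subrr.
by rewrite !nth_default ?subrr ?sp ?sq.
Qed.

Lemma rootpolyE N s : rootpoly N s = \prod_(z <- mkseq s N) ('X - z%:P).
Proof. by rewrite big_map -val_enum_ord big_map big_enum. Qed.

Lemma rootpoly_monic N s : rootpoly N s \is monic.
Proof. exact: monic_prod_XsubC. Qed.

Lemma size_rootpoly N s : size (rootpoly N s) = N.+1.
Proof. by rewrite rootpolyE size_prod_XsubC size_mkseq. Qed.

Lemma horner_rootpoly N s x : (rootpoly N s).[x] = \prod_(i < N) (x - s i).
Proof. by rewrite horner_prod; apply: eq_bigr => i _; rewrite hornerXsubC. Qed.

Lemma rootpoly_root N s k : (k < N)%N -> (rootpoly N s).[s k] = 0.
Proof.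
by move=> kN; rewrite horner_rootpoly (bigD1 (Ordinal kN)) //= subrr mul0r.
Qed.

Lemma rootpolyS N s :
  rootpoly N.+1 s = ('X - (s 0%N)%:P) * rootpoly N (s \o S).
Proof. by rewrite /rootpoly big_ord_recl. Qed.

Lemma rootpolyD1 N s (k : 'I_N) :
  rootpoly N s = ('X - (s k)%:P) * \prod_(i < N | i != k) ('X - (s i)%:P).
Proof. exact: bigD1. Qed.

Lemma deriv_rootpoly N s k : (k < N)%N ->
  (rootpoly N s)^`().[s k] = \prod_(i < N | (i : nat) != k) (s k - s i).
Proof.
move=> kN; rewrite (rootpolyD1 s (Ordinal kN)) derivM derivXsubC mul1r.
rewrite hornerD hornerM hornerXsubC subrr mul0r addr0 horner_prod /=.
by apply: eq_big => [i //|i _]; rewrite hornerXsubC.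
Qed.

Lemma increasing_le N s i j : increasing_upto N s -> (i <= j < N)%N ->
  s i <= s j.
Proof.
by move=> inc /andP[]; rewrite leq_eqVlt => /predU1P[->//|ij jN];
  rewrite ltW// inc// ij.
Qed.

Lemma increasing_upto_uniq N s : increasing_upto N s -> uniq (mkseq s N).
Proof.
move=> inc; apply/mkseq_uniqP => i j; rewrite !inE => iN jN sij.
case: (ltngtP i j) => // ij.
  by have := inc i j; rewrite ij jN sij ltxx => /(_ isT).
by have := inc j i; rewrite ij iN sij ltxx => /(_ isT).
Qed.

Lemma increasing_upto_sorted N s : increasing_upto N s ->
  sorted <%R (mkseq s N).
Proof.
move=> inc; apply/(sortedP 0) => i; rewrite size_mkseq => iN.
by rewrite !nth_mkseq ?(ltnW iN)// inc// ltnSn.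
Qed.

Lemma laced_inc N s u : laced N s u -> increasing_upto N s.
Proof.
move=> [su us] i j /andP[ij jN]; elim: j ij jN => // j IH.
rewrite ltnS leq_eqVlt => /predU1P[->|ij] jN.
  exact: lt_trans (su _ (ltnW jN)) (us _ jN).
apply: lt_trans (IH ij (ltnW jN)) _.
exact: lt_trans (su _ (ltnW jN)) (us _ jN).
Qed.

Lemma laced_inc_r N s u : laced N s u -> increasing_upto N u.
Proof.
move=> su i j /andP[ij jN]; have inc := laced_inc su; case: su => su us.
apply: (lt_le_trans (us i (leq_ltn_trans ij jN))).
by apply: le_trans (ltW (su _ jN)); apply: (increasing_le inc); rewrite ij.
Qed.

Lemma rootpoly_inj N s u : increasing_upto N s -> increasing_upto N u ->
  rootpoly N s = rootpoly N u -> forall k, (k < N)%N -> s k = u k.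
Proof.
move=> incs incu; rewrite !rootpolyE => /prod_XsubC_eq/perm_mem E k kN.
have := lt_sorted_eq (increasing_upto_sorted incs)
  (increasing_upto_sorted incu) E.
by move/(congr1 (fun t => nth 0 t k)); rewrite !nth_mkseq.
Qed.

(** * Sign characterization of strict interlacing *)

Lemma deriv_rootpoly_neq0 N s k : increasing_upto N s -> (k < N)%N ->
  (rootpoly N s)^`().[s k] != 0.
Proof.
move=> inc kN; rewrite deriv_rootpoly//; apply/prodf_neq0 => i ik.
rewrite subr_eq0; case: (ltngtP i k) ik => // ik _.
  by rewrite gt_eqF// inc// ik.
by rewrite lt_eqF// inc// ik ltn_ord.
Qed.

(* Each factor, except those of index [k] and [k.+1], has the same sign at
   both points. *)
Lemma deriv_rootpoly_alt N s k : increasing_upto N s -> (k.+1 < N)%N ->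
  (rootpoly N s)^`().[s k] * (rootpoly N s)^`().[s k.+1] < 0.
Proof.
move=> inc kN; have kN' := ltnW kN; rewrite !deriv_rootpoly//.
have kk : k.+1 != k by rewrite gtn_eqF.
rewrite (bigD1 (Ordinal kN)) //= [X in _ * X](bigD1 (Ordinal kN')) /=; last first.
  by rewrite eq_sym.
under [X in _ * (_ * X)]eq_bigl do rewrite andbC.
rewrite mulrACA -big_split /= pmulr_llt0.
  have := inc k k.+1; rewrite ltnSn kN => /(_ isT) lt_s.
  by rewrite nmulr_rlt0 ?subr_gt0 ?subr_lt0.
apply: prodr_gt0 => i /andP[ik iSk].
have [ki|ik'] : (k.+1 < i \/ i < k)%N.
- by move: ik iSk; rewrite -!(inj_eq val_inj) /=; lia.
- by rewrite nmulr_rgt0 subr_lt0 inc ?ki ?ltn_ord// (ltn_trans _ ki) ?ltn_ord.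
- by rewrite pmulr_rgt0 subr_gt0 inc ?ik'// (ltn_trans ik').
Qed.

Lemma deriv_rootpoly_last N s : increasing_upto N.+1 s ->
  0 < (rootpoly N.+1 s)^`().[s N].
Proof.
move=> inc; rewrite deriv_rootpoly//; apply: prodr_gt0 => i iN.
by rewrite subr_gt0 inc// ltnSn andbT ltn_neqAle iN -ltnS ltn_ord.
Qed.

(** The derivative of [rootpoly N s] alternates in sign along the zeros [s], hence so does [q],
    which is negative at the last one and positive far to the right. The intermediate value theorem
    yields [N] distinct zeros, all that the degree allows. *)
Lemma laced_of_sign N s q : increasing_upto N s -> q \is monic ->
  size q = N.+1 ->
  (forall k, (k < N)%N -> q.[s k] * (rootpoly N s)^`().[s k] < 0) ->
  exists2 u, laced N s u & q = rootpoly N u.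
Proof.
move=> inc qm sq sgn.
have ex k : exists x, (k < N)%N ==>
    [&& s k < x, (k.+1 < N)%N ==> (x < s k.+1) & root q x].
  (* Out of range the condition is vacuous and 0 is a dummy, so that choice gives a total [u]. *)
  case: (ltnP k N) => kN; last by exists 0.
  case: (ltnP k.+1 N) => kN1.
  - have lt_s : s k < s k.+1 by rewrite inc// ltnSn.
    have qq : q.[s k] * q.[s k.+1] < 0.
      have A := deriv_rootpoly_alt inc kN1.
      have := sgn _ kN; have := sgn _ kN1; move: A.
      move: (_^`().[s k]) (_^`().[s k.+1]) q.[s k] q.[s k.+1] => a b c d ab db ca.
      have : 0 < c * a * (d * b) by rewrite nmulr_lgt0.
      by rewrite mulrACA nmulr_lgt0.
    have [x /itvP xin xr] := polyrcf.poly_ivtoo (ltW lt_s) qq.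
    by exists x; rewrite !xin.
  - have Nk : N = k.+1 by lia.
    have qk : q.[s k] < 0.
      have := sgn _ kN; have := @deriv_rootpoly_last k s; rewrite -Nk.
      by move=> /(_ inc) D; rewrite pmulr_llt0.
    (* From [B] on, [q] is at least its leading coefficient 1. *)
    have [|B HB] := @polyrcf.poly_pinfty_gt_lc _ q; first by rewrite (monicP qm).
    pose b := Num.max B (s k + 1).
    have sb : s k < b by rewrite lt_max ltrDl ltr01 orbT.
    have qb : q.[s k] * q.[b] < 0.
      rewrite nmulr_rlt0//; apply: lt_le_trans (HB b _).
        by rewrite (monicP qm).
      by rewrite le_max lexx.
    have [x /itvP xin xr] := polyrcf.poly_ivtoo (ltW sb) qb.
    by exists x; rewrite !xin.
pose u k := xchoose (ex k).
have uP k : (k < N)%N ->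
    [/\ s k < u k, (k.+1 < N)%N -> u k < s k.+1 & root q (u k)].
  by move=> kN; have /implyP/(_ kN)/and3P[? /implyP ? ?] := xchooseP (ex k).
have su : laced N s u.
  by split=> k kN; [have [] := uP k kN | have [_ + _] := uP k (ltnW kN); exact].
exists u => //.
rewrite rootpolyE; rewrite [LHS](@all_roots_prod_XsubC _ q (mkseq u N)).
- by rewrite (monicP qm) scale1r.
- by rewrite size_mkseq.
- by apply/allP => _ /mapP[k + ->]; rewrite mem_iota => /andP[_ kN];
    have [] := uP k kN.
- by rewrite uniq_rootsE increasing_upto_uniq//; exact: laced_inc_r su.
Qed.

(** Converse of [laced_of_sign]: for i other than k the factors s_k - u_i and s_k - s_i have the
    same sign, and the unpaired factor s_k - u_k is negative. *)
Lemma laced_sign N s u k : laced N s u -> (k < N)%N ->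
  (rootpoly N u).[s k] * (rootpoly N s)^`().[s k] < 0.
Proof.
move=> su kN; have incs := laced_inc su; have incu := laced_inc_r su.
case: su => su us; rewrite deriv_rootpoly// horner_rootpoly.
rewrite (bigD1 (Ordinal kN)) //= -mulrA nmulr_rlt0 ?subr_lt0 ?su//.
rewrite -big_split /=; apply: prodr_gt0 => i.
rewrite -(inj_eq val_inj) /=; case: ltngtP => // ik _.
- apply: mulr_gt0; rewrite subr_gt0 ?incs ?ik//.
  apply: lt_le_trans (us _ (leq_ltn_trans ik kN)) _.
  by apply: (increasing_le incs); rewrite ik.
- rewrite -mulrNN; apply: mulr_gt0; rewrite opprB subr_gt0 ?incs ?ik ?ltn_ord//.
  by apply: lt_trans (su k kN) _; rewrite incu ?ik ?ltn_ord.
Qed.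

(** The same pairing at the zeros of [u], where the unpaired factor u_k - s_k is positive. *)
Lemma laced_sign_r N s u k : laced N s u -> (k < N)%N ->
  0 < (rootpoly N s).[u k] * (rootpoly N u)^`().[u k].
Proof.
move=> su kN; have incs := laced_inc su; have incu := laced_inc_r su.
case: su => su us; rewrite deriv_rootpoly// horner_rootpoly.
rewrite (bigD1 (Ordinal kN)) //= -mulrA pmulr_rgt0 ?subr_gt0 ?su//.
rewrite -big_split /=; apply: prodr_gt0 => i.
rewrite -(inj_eq val_inj) /=; case: ltngtP => // ik _.
- apply: mulr_gt0; rewrite subr_gt0 ?incu ?ik//.
  by apply: lt_trans (su k kN); rewrite incs ?ik.
- rewrite -mulrNN; apply: mulr_gt0; rewrite opprB subr_gt0 ?incu ?ik ?ltn_ord//.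
  apply: lt_le_trans (us _ (leq_ltn_trans ik (ltn_ord i))) _.
  by apply: (increasing_le incs); rewrite ik ltn_ord.
Qed.

(* Lagrange interpolation of [q - p] at the zeros of [p]. *)
Lemma laced_interpolation N s u : laced N s u ->
  exists2 d : 'I_N -> R, forall i, d i < 0 &
  rootpoly N u = rootpoly N s +
    \sum_(i < N) d i *: \prod_(j < N | j != i) ('X - (s j)%:P).
Proof.
move=> su; have incs := laced_inc su.
pose w (i : 'I_N) : {poly R} := \prod_(j < N | j != i) ('X - (s j)%:P).
have wE i : (w i).[s i] = (rootpoly N s)^`().[s i].
  rewrite deriv_rootpoly// horner_prod.
  by apply: eq_big => [//|j _]; rewrite hornerXsubC.
have w0 i j : j != i -> (w i).[s j] = 0.
  by move=> ji; rewrite horner_prod (bigD1 j)//= hornerXsubC subrr mul0r.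
have sw i : (size (w i) <= N)%N.
  have := size_rootpoly N s; rewrite (rootpolyD1 s i) size_monicM ?monicXsubC//.
    by rewrite size_XsubC -/(w i) add2n /= => -[->].
  exact/monic_neq0/monic_prod_XsubC.
pose d (i : 'I_N) := (rootpoly N u).[s i] / (rootpoly N s)^`().[s i].
have dwE (j : 'I_N) : (\sum_(i < N) d i *: w i).[s j] = (rootpoly N u).[s j].
  rewrite horner_sum (bigD1 j)//= hornerZ wE big1 ?addr0; last first.
    by move=> i ij; rewrite hornerZ w0 ?mulr0// eq_sym.
  by rewrite /d mulfVK// deriv_rootpoly_neq0.
exists d => [i|].
  have := laced_sign su (ltn_ord i); rewrite /d.
  have D := deriv_rootpoly_neq0 incs (ltn_ord i).
  have -> : forall a b : R, b != 0 -> a / b = a * b / b ^+ 2.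
    by move=> a b b0; field.
  by move=> lt0; rewrite pmulr_llt0// invr_gt0 exprn_even_gt0.
  exact: D.
apply/eqP; rewrite -subr_eq0; apply/eqP.
(* The difference of the two sides has degree below [N], since the leading terms cancel, and it
   vanishes at [N] distinct points. *)
apply: (@roots_geq_poly_eq0 _ _ (mkseq s N)).
- apply/allP => _ /mapP[k + ->]; rewrite mem_iota => /andP[_ kN].
  rewrite /root opprD addrA !hornerE rootpoly_root// subr0.
  by rewrite (dwE (Ordinal kN)) subrr.
- exact: increasing_upto_uniq.
rewrite size_mkseq opprD addrA (leq_trans (size_polyD _ _))// geq_max.
rewrite size_polyN; apply/andP; split; last first.
  apply: leq_trans (size_sum _ _ _) _; apply/bigmax_leqP => i _.
  exact: leq_trans (size_scale_leq _ _) (sw i).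
by apply: size_monicB; rewrite ?rootpoly_monic ?size_rootpoly.
Qed.

End Interlacing.

(** * The raising operators *)

Section Raising.
Variable R : rcfType.
Implicit Types (s u v : nat -> R) (p q : {poly R}) (N : nat) (b : R).

(* [x^b e^{-x} (raise b p) = - (x^{b+1} e^{-x} p)'] *)
Definition raise b p := ('X - (1 + b)%:P) * p - 'X * p^`().

Lemma raiseD b p q : raise b (p + q) = raise b p + raise b q.
Proof. by rewrite /raise derivD; ring. Qed.

Lemma raiseZ b c p : raise b (c *: p) = c *: raise b p.
Proof. by rewrite /raise derivZ -!mul_polyC; ring. Qed.

Lemma horner_raise b p x :
  (raise b p).[x] = (x - (1 + b)) * p.[x] - x * p^`().[x].
Proof. by rewrite !hornerE. Qed.

Lemma raise_sum b (I : finType) (F : I -> {poly R}) :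
  raise b (\sum_i F i) = \sum_i raise b (F i).
Proof.
apply: (big_morph _ (raiseD b)).
by rewrite /raise deriv0 !mulr0 subrr.
Qed.

Lemma raise_shift b c p : raise (b + c) p = raise b p - c *: p.
Proof. by rewrite /raise addrA polyCD -!mul_polyC; ring. Qed.

Lemma deriv_raise b p : (raise b p)^`() = p + raise (b + 1) p^`().
Proof. by rewrite /raise !poly.derivE !polyCD; ring. Qed.

(** Any two of these operators differ by a scalar multiple of the identity. *)
Lemma raiseC b c p : raise b (raise c p) = raise c (raise b p).
Proof. by rewrite {1 3}/raise !deriv_raise /raise !polyCD; ring. Qed.

Lemma raise_XsubM b a p :
  raise b (('X - a%:P) * p) = ('X - a%:P) * raise b p - 'X * p.
Proof. by rewrite /raise derivM derivXsubC; ring. Qed.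

Lemma raise_monic b p : p \is monic -> raise b p \is monic.
Proof.
move=> pm; rewrite monicE lead_coefDl.
  by rewrite lead_coef_Mmonic// lead_coefXsubC.
rewrite size_polyN size_monicM ?monicXsubC ?monic_neq0// size_XsubC add2n ltnS.
have [->|p'0] := eqVneq p^`() 0; first by rewrite mulr0 size_poly0.
by rewrite mulrC size_mulX// lt_size_deriv ?monic_neq0.
Qed.

Lemma size_raise b p : p \is monic -> size (raise b p) = (size p).+1.
Proof.
move=> pm; rewrite size_polyDl.
  by rewrite size_monicM ?monicXsubC ?monic_neq0// size_XsubC.
rewrite size_polyN size_monicM ?monicXsubC ?monic_neq0// size_XsubC add2n ltnS.
have [->|p'0] := eqVneq p^`() 0; first by rewrite mulr0 size_poly0.
by rewrite mulrC size_mulX// lt_size_deriv ?monic_neq0.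
Qed.

(** Adjoining the zero 0, that is passing from p to x p, turns interlacing between degrees N and N+1
    into the equal-degree relation [laced]. *)
Definition cons0 s k := if k is k'.+1 then s k' else 0.

Definition positive_upto N s := forall k, (k < N)%N -> 0 < s k.

Lemma laced_positive N s u : positive_upto N s -> laced N s u ->
  positive_upto N u.
Proof. by move=> s0 [su _] k kN; apply: lt_trans (su k kN); exact: s0. Qed.

Lemma laced_cons0_positive N s v : laced N (cons0 s) v -> positive_upto N v.
Proof.
move=> sv; have [{}s0 _] := sv; move=> k kN; apply: le_lt_trans (s0 k kN).
by apply: (increasing_le (i := 0%N) (laced_inc sv)); rewrite leq0n.
Qed.

Lemma rootpoly_cons0 N s : rootpoly N.+1 (cons0 s) = 'X * rootpoly N s.
Proof. by rewrite rootpolyS /= subr0. Qed.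

(* [x^{b+1} e^{-x} p] vanishes at [0], at the zeros of [p] and at infinity. *)
Lemma raise_laced N b s : -1 < b -> increasing_upto N s -> positive_upto N s ->
  exists2 v, laced N.+1 (cons0 s) v & raise b (rootpoly N s) = rootpoly N.+1 v.
Proof.
move=> b1 inc pos; apply: laced_of_sign.
- case=> [|i] [|j]//=; rewrite !ltnS; last exact: inc.
  exact: pos.
- exact/raise_monic/rootpoly_monic.
- by rewrite size_raise ?rootpoly_monic// size_rootpoly.
rewrite rootpoly_cons0 derivM derivX mul1r => -[_|k] /=.
  (* At 0 the derivative of x p is p(0), and [raise b p] is -(1 + b) p(0). *)
  have P0 : (rootpoly N s).[0] != 0.
    rewrite horner_rootpoly; apply/prodf_neq0 => i _.
    by rewrite sub0r oppr_eq0 gt_eqF// pos.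
  rewrite horner_raise hornerD hornerM hornerX !mul0r addr0 subr0 sub0r mulNr.
  rewrite mulNr -mulrA -expr2.
  by rewrite oppr_lt0 mulr_gt0 ?exprn_even_gt0//; lra.
(* At a zero z of p the two values are z p'(z) and its opposite. *)
rewrite ltnS => kN; rewrite horner_raise hornerD hornerM hornerX.
rewrite rootpoly_root// mulr0 !add0r.
rewrite mulNr -expr2 oppr_lt0 exprn_even_gt0//= mulf_neq0//.
  by rewrite gt_eqF ?pos.
exact: deriv_rootpoly_neq0.
Qed.

(* With [q = p + \sum_i d_i *: p_i] and [p = ('X - s_i) p_i], at a zero [z] of
   [raise b p] one has [raise b q (z) = z p(z) \sum_i d_i / (z - s_i)^2]. *)
Lemma raise_laced_laced N b s u v : laced N.+1 s u ->
  laced N.+2 (cons0 s) v -> raise b (rootpoly N.+1 s) = rootpoly N.+2 v ->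
  exists2 v', laced N.+2 v v' & raise b (rootpoly N.+1 u) = rootpoly N.+2 v'.
Proof.
move=> su sv E; have posv := laced_cons0_positive sv.
apply: laced_of_sign.
- exact: laced_inc_r sv.
- exact/raise_monic/rootpoly_monic.
- by rewrite size_raise ?rootpoly_monic// size_rootpoly.
move=> k kN; have z0 := posv _ kN.
have := laced_sign_r sv kN; rewrite rootpoly_cons0 hornerM hornerX -mulrA.
rewrite pmulr_rgt0// => pm0.
have root0 : (raise b (rootpoly N.+1 s)).[v k] = 0 by rewrite E rootpoly_root.
have [d d0 ->] := laced_interpolation su.
rewrite raiseD hornerD root0 add0r raise_sum horner_sum big_distrl /=.
have lt0 i : (raise b (d i *: \prod_(j < N.+1 | j != i) ('X - (s j)%:P))).[v k] *
    (rootpoly N.+2 v)^`().[v k] < 0.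
  move: root0 pm0; rewrite (rootpolyD1 s i) raise_XsubM raiseZ hornerZ.
  move: (\prod_(j < N.+1 | j != i) _) => w.
  rewrite hornerD hornerN !hornerM hornerXsubC hornerX; move: (raise b w).[v k] (w.[v k]) (v k - s i) => x y c.
  move: ((rootpoly _ v)^`().[v k]) => m; move: (v k) z0 (d i) (d0 i) => z z0 e e0 /eqP.
  rewrite subr_eq0 => /eqP cx cym.
  (* Here [c * y] is p(z), which is nonzero, and [x = z * y / c] because z is a zero of
     [raise b p]. *)
  have c0 : c != 0 by apply: contraTneq cym => ->; rewrite !mul0r ltxx.
  rewrite -mulrA nmulr_rlt0//.
  have -> : x * m = z * (c * y * m) / c ^+ 2.
    have -> : x = z * y / c by rewrite -cx mulrC mulKf.
    by field.
  by rewrite divr_gt0 ?exprn_even_gt0// mulr_gt0.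
(* The degree [N.+1] provides at least one term, so the sum is strictly negative. *)
rewrite big_ord_recl; apply: ltr_wnDr; last exact: lt0.
by apply: sumr_le0 => i _; exact/ltW/lt0.
Qed.

(** At a zero z of [raise b p] the value of [raise b' p] is -(b' - b) p(z), and [laced_sign_r] gives
    the sign of z p(z). *)
Lemma raise_lt N b b' s v : b < b' -> laced N.+1 (cons0 s) v ->
  raise b (rootpoly N s) = rootpoly N.+1 v ->
  exists2 v', laced N.+1 v v' & raise b' (rootpoly N s) = rootpoly N.+1 v'.
Proof.
move=> bb' sv E; have posv := laced_cons0_positive sv.
apply: laced_of_sign.
- exact: laced_inc_r sv.
- exact/raise_monic/rootpoly_monic.
- by rewrite size_raise ?rootpoly_monic// size_rootpoly.
move=> k kN; have z0 := posv _ kN.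
have := laced_sign_r sv kN; rewrite rootpoly_cons0 hornerM hornerX -mulrA.
rewrite pmulr_rgt0// => pm0.
have -> : b' = b + (b' - b) by rewrite addrC subrK.
rewrite raise_shift hornerD E rootpoly_root// add0r hornerN hornerZ mulNr -mulrA.
by rewrite oppr_lt0 mulr_gt0// subr_gt0.
Qed.

(** * Iterated raising operators *)

(** By [mellin_lag], the moments of [lag l] against x^b e^{-x} vanish for every b > -1 in [l]. *)
Definition lag (l : seq R) : {poly R} := foldr raise 1 l.

Lemma lag_monic l : lag l \is monic.
Proof. by elim: l => [|b l IH] /=; [exact: monic1 | exact: raise_monic]. Qed.

Lemma size_lag l : size (lag l) = (size l).+1.
Proof.
elim: l => [|b l IH] /=; first exact: size_poly1.
by rewrite size_raise ?IH ?lag_monic.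
Qed.

Definition posroots N s p :=
  [/\ increasing_upto N s, positive_upto N s & p = rootpoly N s].

Lemma lag_posroots (l : seq R) : all (> -1) l ->
  exists s, posroots (size l) s (lag l).
Proof.
elim: l => [|b l IH] /=.
  by exists (fun=> 0); split=> [i j|//|]; rewrite ?ltn0 ?andbF// /rootpoly big_ord0.
move=> /andP[b1 /IH[s [inc pos ->]]].
have [v sv E] := raise_laced b1 inc pos.
exists v; split => //; [exact: laced_inc_r sv | exact: laced_cons0_positive sv].
Qed.

Lemma posroots_uniq N s u p : posroots N s p -> posroots N u p ->
  forall k, (k < N)%N -> s k = u k.
Proof. by move=> [incs _ ->] [incu _]; exact: rootpoly_inj. Qed.

Lemma lag_cat_cons (s t : seq R) b : lag (s ++ b :: t) = lag (b :: s ++ t).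
Proof. by elim: s => //= c s ->; rewrite /= raiseC. Qed.

Lemma lag_perm (s t : seq R) : perm_eq s t -> lag s = lag t.
Proof.
move: s t; apply: catCA_perm_subst => s1 s2 s3.
elim: s1 => //= b s1 IH; by rewrite IH lag_cat_cons.
Qed.

(** The parameters are increased one at a time; [pre] collects those that already have their final
    value. *)
Lemma lag_monotone (l l' pre : seq R) s u N :
  all (> -1) (pre ++ l) -> all2 <=%R l l' ->
  posroots N s (lag (pre ++ l)) -> posroots N u (lag (pre ++ l')) ->
  N = size (pre ++ l) -> forall k, (k < N)%N -> s k <= u k.
Proof.
elim: l l' pre s u => [|b l IH] [|b' l'] pre s u //.
  by move=> _ _ ls lu _ k kN; rewrite (posroots_uniq ls lu).
move=> A /= /andP[bb' ll'] ls lu EN k kN.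
have b1 : -1 < b by move: A; rewrite all_cat /= => /and3P[].
have b'1 : -1 < b' by exact: lt_le_trans bb'.
have Apre : all (> -1) (pre ++ l).
  by move: A; rewrite !all_cat /= => /and3P[-> _ ->].
have [h [inch posh hE]] := lag_posroots Apre.
have szN : N = (size (pre ++ l)).+1 by rewrite EN !size_cat addnS.
have A' : all (> -1) (rcons pre b' ++ l).
  by move: Apre; rewrite cat_rcons !all_cat /= b'1.
have [w wE] := lag_posroots A'.
have szw : size (rcons pre b' ++ l) = N by rewrite szN cat_rcons !size_cat addnS.
rewrite szw in wE.
apply: (@le_trans _ _ (w k)); last first.
  apply: (IH l' (rcons pre b') w u) => //; rewrite ?cat_rcons//.
(* The parameter being changed is moved outermost, so that both polynomials are raised from the same
   one and [raise_lt] compares them. *)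
move: ls wE; rewrite cat_rcons !lag_cat_cons /= hE.
have [v sv E] := raise_laced b1 inch posh.
rewrite szN in kN *; move=> ls wE.
have vp : posroots (size (pre ++ l)).+1 v (raise b (rootpoly (size (pre ++ l)) h)).
  by split=> //; [exact: laced_inc_r sv | exact: laced_cons0_positive sv].
rewrite (posroots_uniq ls vp)//.
move: bb'; rewrite le_eqVlt => /predU1P[bb'|bb'].
  by move: wE; rewrite -bb' => wE; rewrite (posroots_uniq wE vp).
have [v' vv' E'] := raise_lt bb' sv E.
have v'p : posroots (size (pre ++ l)).+1 v' (raise b' (rootpoly (size (pre ++ l)) h)).
  split=> //; first exact: laced_inc_r vv'.
  by apply: laced_positive vv'; case: vp.
by rewrite (posroots_uniq wE v'p)// ltW//; case: vv' => + _; exact.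
Qed.

(** Adding common parameters preserves strict interlacing, one [raise_laced_laced] at a time; only
    the block of the changing index remains to be treated. *)
Lemma lag_laced (l : seq R) N s u p q : all (> -1) l ->
  posroots N.+1 s p -> laced N.+1 s u -> q = rootpoly N.+1 u ->
  exists v v', [/\ posroots (size l + N.+1) v (foldr raise p l),
    laced (size l + N.+1) v v' & foldr raise q l = rootpoly (size l + N.+1) v'].
Proof.
move=> + sp su qE; elim: l => [_|b l IH] /=; first by exists s, u.
move=> /andP[b1 /IH[v [v' [[incv posv ->] vv' ->]]]].
rewrite addnS in incv posv vv' *.
have [w vw E] := raise_laced b1 incv posv.
have [w' ww' E'] := raise_laced_laced vv' vw E.
exists w, w'; rewrite addSn addnS; split => //.
by split=> //; [exact: laced_inc_r vw | exact: laced_cons0_positive vw].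
Qed.

(** * Classical Laguerre polynomials *)

(** For this block of parameters, [lag] is the monic classical Laguerre polynomial of degree [n] and
    parameter [a]. *)
Definition arith (a : R) n := mkseq (fun k => a + k%:R) n.

Lemma arithS a n : arith a n.+1 = a :: arith (a + 1) n.
Proof.
rewrite /arith /mkseq /= addr0 (iotaDl 1 0) -map_comp; congr (_ :: _).
by apply: eq_map => k /=; rewrite add1n -natr1; ring.
Qed.

Lemma lag_arith_shift n a :
  lag (arith (a + 1) n) = lag (arith a n) - (lag (arith a n))^`().
Proof.
elim: n a => [|n IH] a; first by rewrite /= derivC subr0.
rewrite !arithS /= IH deriv_raise.
set p := lag (arith (a + 1) n).
have -> : raise (a + 1) (p - p^`()) = raise (a + 1) p - raise (a + 1) p^`().
  by rewrite -scaleN1r raiseD raiseZ scaleN1r.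
by rewrite (raise_shift a 1 p) scale1r; ring.
Qed.

(** Lowering relation; applying [raise a] to it gives the Laguerre differential equation. *)
Lemma deriv_lag_arith n a :
  (lag (arith a n.+1))^`() = n.+1%:R *: lag (arith (a + 1) n).
Proof.
elim: n a => [|n IH] a.
  by rewrite arithS /= deriv_raise derivC /raise derivC !mulr0 subrr addr0 scale1r.
rewrite arithS [in LHS]/= deriv_raise IH raiseZ.
have -> : raise (a + 1) (lag (arith (a + 1 + 1) n)) = lag (arith (a + 1) n.+1).
  by rewrite arithS.
by rewrite -[in RHS]natr1 scalerDl scale1r addrC.
Qed.

Lemma lag_arith_laced n a s : -1 < a ->
  posroots n s (lag (arith a n)) ->
  exists2 u, laced n s u & lag (arith (a + 2) n) = rootpoly n u.
Proof.
move=> a1 [inc pos E].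
apply: laced_of_sign; rewrite ?lag_monic ?size_lag ?size_mkseq//.
case: n inc pos E => // n inc pos E k kn.
have -> : a + 2 = a + 1 + 1 by ring.
rewrite -E; set p := lag (arith a n.+1).
(* Two unit shifts of the parameter, each of the form p - p'. *)
have -> : lag (arith (a + 1 + 1) n.+1) = p - p^`() - p^`() + p^`()^`().
  by rewrite !lag_arith_shift -/p; move: p => p; rewrite derivB; ring.
have ode : n.+1%:R *: p = raise a p^`().
  by rewrite deriv_lag_arith raiseZ /p arithS.
have pk : p.[s k] = 0 by rewrite /p E rootpoly_root.
have p'k : p^`().[s k] != 0 by rewrite /p E deriv_rootpoly_neq0.
have : (n.+1%:R *: p).[s k] = (raise a p^`()).[s k] by rewrite ode.
rewrite hornerZ horner_raise pk mulr0.
move=> /esym/eqP; rewrite subr_eq0 => /eqP odek.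
have z0 := pos _ kn.
clear ode; clearbody p.
rewrite !hornerD !hornerN pk add0r; move: odek p'k z0.
move: (p^`()^`().[s k]) (p^`().[s k]) => y x; move: (s k) => z odek x0 z0.
(* After multiplication by z > 0, the differential equation replaces z p''(z) by (z - 1 - a)
   p'(z). *)
rewrite -(pmulr_rlt0 _ z0).
have -> : z * ((- x - x + y) * x) = - ((z + 1 + a) * x ^+ 2).
  have -> : z * ((- x - x + y) * x) = (z * y - z * x *+ 2) * x by ring.
  by rewrite -odek; ring.
by rewrite oppr_lt0 mulr_gt0 ?exprn_even_gt0//; lra.
Qed.

End Raising.

(** * Moments of the Gamma weight *)

Section GammaIntegral.
Variable R : realType.
Local Notation mu := (@lebesgue_measure R).
Implicit Types (s : R).

Definition gamma_fun s (x : R) : R := x `^ s * expR (- x).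

(* In the usual notation this is [Gamma (s + 1)]. *)
Definition gamma_int s : \bar R :=
  (\int[mu]_(x in `]0%R, +oo[) (gamma_fun s x)%:E)%E.

Lemma gamma_fun_ge0 s x : 0 <= gamma_fun s x.
Proof. by rewrite mulr_ge0 ?powR_ge0 ?expR_ge0. Qed.

Lemma measurable_gamma_fun s (D : set R) : measurable_fun D (gamma_fun s).
Proof.
apply: (@measurable_funS _ _ _ _ setT) => //.
apply: measurable_funM; first exact: measurable_powR.
by apply: measurableT_comp => //; exact: measurable_expR.
Qed.

Lemma measurable_gamma_funE s (D : set R) :
  measurable_fun D (fun x : R => (gamma_fun s x)%:E).
Proof. by apply/measurable_EFinP; exact: measurable_gamma_fun. Qed.

Lemma continuous_gamma_fun s (x : R) : 0 < x -> {for x, continuous (gamma_fun s)}.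
Proof.
move=> x0.
have c1 : {for x, continuous (fun y : R => y `^ s)}.
  apply: differentiable_continuous; apply/derivable1_diffP.
  by apply: derivable_powR; rewrite in_itv/= x0.
have c2 : {for x, continuous (fun y : R => expR (- y))}.
  apply: continuous_comp; [exact: continuousN | exact: continuous_expR].
exact: (cvgM c1 c2).
Qed.

(** Integration by parts, on a segment away from 0, where x^s may be unbounded. *)
Lemma gamma_segment s (a b : R) : 0 < a -> a < b ->
  (\int[mu]_(x in `[a, b]) (gamma_fun (s + 1) x)%:E =
   (gamma_fun (s + 1) a - gamma_fun (s + 1) b)%:E +
   (s + 1)%:E * \int[mu]_(x in `[a, b]) (gamma_fun s x)%:E)%E.
Proof.
move=> a0 ab.
have pos x : x \in `[a, b] -> 0 < x.
  by rewrite in_itv/= => /andP[ax _]; exact: lt_le_trans ax.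
pose f x := (s + 1) * gamma_fun s x - gamma_fun (s + 1) x.
have contw u : {within `[a, b], continuous (gamma_fun u)}.
  apply: continuous_in_subspaceT => x /[!inE] /pos; exact: continuous_gamma_fun.
have intg u : mu.-integrable `[a, b] (EFin \o gamma_fun u).
  by apply: continuous_compact_integrable => //; exact: segment_compact.
have dF (x : R) : 0 < x -> is_derive x 1 (gamma_fun (s + 1)) (f x).
  move=> x0; rewrite /gamma_fun.
  have := is_derive1_powR (s + 1) x0; rewrite addrK => d1.
  apply: is_derive_eq; rewrite /f /gamma_fun /=.
  by rewrite /GRing.scale /=; ring.
have cf (x : R) : 0 < x -> {for x, continuous f}.
  move=> x0; apply: cvgB; last exact: continuous_gamma_fun.
  by apply: cvgM; [exact: cvg_cst | exact: continuous_gamma_fun].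
have E := @continuous_FTC2 R f (gamma_fun (s + 1)) a b ab.
have {}E : (\int[mu]_(x in `[a, b]) (f x)%:E =
    (gamma_fun (s + 1) b)%:E - (gamma_fun (s + 1) a)%:E)%E.
  apply: E.
  - by apply: continuous_in_subspaceT => x /[!inE] /pos; exact: cf.
  - split.
    + move=> x; rewrite in_itv/= => /andP[ax _].
      by have [] := dF _ (lt_trans a0 ax).
    + exact/cvg_at_right_filter/continuous_gamma_fun.
    + exact/cvg_at_left_filter/continuous_gamma_fun/(lt_trans a0).
  - move=> x; rewrite in_itv/= => /andP[ax _].
    by rewrite derive1E; have [_] := dF _ (lt_trans a0 ax).
move: E; rewrite /f.
under eq_integral do rewrite EFinB EFinM.
rewrite integralB//=; first last.
- exact: intg.
- by apply: integrableZl => //; exact: intg.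
rewrite integralZl//; last exact: intg.
have fin u : (\int[mu]_(x in `[a, b]) (gamma_fun u x)%:E \is a fin_num)%E.
  by apply: integrable_fin_num => //; exact: intg.
rewrite -(fineK (fin s)) -(fineK (fin (s + 1))).
rewrite -!EFinM -!EFinB => -[E]; rewrite -EFinD; congr (_%:E).
move: E; move: (fine _) (fine _) => u v E; rewrite -opprB -E; ring.
Qed.

(** Comes from the term x^{m+1} / (m+1)! of the exponential series. *)
Lemma gamma_fun_le_inv (m : nat) s (x : R) : s <= m%:R -> 1 <= x ->
  gamma_fun s x <= m.+1`!%:R * x^-1.
Proof.
move=> sm x1; have x0 : 0 < x by exact: lt_le_trans x1.
have m0 : 0 < m.+1`!%:R :> R by rewrite ltr0n fact_gt0.
apply: (@le_trans _ _ (x ^+ m * expR (- x))).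
  by rewrite ler_wpM2r ?expR_ge0// -powR_mulrn ?(ltW x0)// ler_powR.
have := expR_ge1Dxn m (ltW x0) => E.
have {}E : x ^+ m.+1 / m.+1`!%:R <= expR x.
  by apply: le_trans E; rewrite lerDr.
rewrite expRN ler_pdivrMr ?expR_gt0// mulrAC ler_pdivlMr// -exprSr.
by rewrite mulrC -ler_pdivrMr.
Qed.

Lemma gamma_fun_natr_cvg0 s : gamma_fun s n.+2%:R @[n --> \oo] --> 0.
Proof.
pose m := (Num.truncn `|s|).+1.
have sm : s <= m%:R by rewrite (le_trans (ler_norm s))// ltW// truncnS_gt.
apply: (@squeeze_cvgr _ _ _ _ (fun=> 0) (fun n => m.+1`!%:R * n.+2%:R^-1)).
- near=> n; rewrite gamma_fun_ge0/=.
  by apply: gamma_fun_le_inv => //; rewrite ler1n.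
- exact: cvg_cst.
- rewrite -[X in _ --> X](mulr0 (m.+1`!%:R)).
  by apply: cvgMr; have := @cvg_harmonic R; rewrite -cvg_shiftS.
Unshelve. all: by end_near. Qed.

Lemma gamma_fun_le_powR s (x : R) : 0 <= x -> gamma_fun s x <= x `^ s.
Proof.
move=> x0; rewrite ler_piMr ?powR_ge0//.
by rewrite expRN invf_le1 ?expR_gt0// -expR0 ler_expR.
Qed.

Lemma gamma_fun_invn_cvg0 s : 0 < s -> gamma_fun s n.+2%:R^-1 @[n --> \oo] --> 0.
Proof.
move=> s0.
have inv0 : (n.+2%:R^-1 : R) @[n --> \oo] --> 0.
  by have := @cvg_harmonic R; rewrite -cvg_shiftS.
apply: (@squeeze_cvgr _ _ _ _ (fun=> 0) (fun n => (n.+2%:R^-1) `^ s)).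
- near=> n; rewrite gamma_fun_ge0/= gamma_fun_le_powR//.
- exact: cvg_cst.
- have /cvg_at_rightP := powR_cvg0 s0; apply; split => // n.
Unshelve. all: by end_near. Qed.

(** Monotone convergence along segments that exhaust the half-line. The offset 2 keeps the endpoints
    distinct at n = 0, as [gamma_segment] requires. *)
Lemma gamma_int_cvg s :
  (\int[mu]_(x in `[(n.+2%:R^-1)%R, n.+2%:R%R]) (gamma_fun s x)%:E)%E @[n --> \oo]
    --> gamma_int s.
Proof.
pose E n : set R := [set` `[n.+2%:R^-1, n.+2%:R]].
have -> : gamma_int s = (\int[mu]_(x in \bigcup_n E n) (gamma_fun s x)%:E)%E.
  congr (integral _ _ _); apply/seteqP; split => x /=; rewrite in_itv/= ?andbT.
    move=> x0; pose n := Num.truncn (Num.max x x^-1); exists n => //=.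
    have : Num.max x x^-1 < n.+2%:R.
      by rewrite (lt_trans (truncnS_gt _))// ltr_nat.
    rewrite gt_max => /andP[xM xM'].
    have nx : n.+2%:R^-1 <= x.
      by rewrite -[leRHS]invrK lef_pV2 ?posrE ?invr_gt0 ?ltr0n//; exact: ltW.
    by apply/andP; split; [exact: nx | exact: ltW].
  move=> [n _ /=] /andP[nx _].
  have n0 : 0 < n.+2%:R^-1 :> R by rewrite invr_gt0 ltr0n.
  exact: lt_le_trans n0 nx.
have H := @ge0_nondecreasing_set_cvg_integral _ (measurableTypeR R) R E
  (fun x => (gamma_fun s x)%:E) lebesgue_measure.
apply: H.
- apply/nondecreasing_seqP => n; rewrite subsetEset /E => x /=.
  rewrite !in_itv/= => /andP[a b]; apply/andP; split.
    by apply: le_trans a; rewrite lef_pV2 ?posrE ?ltr0n// ler_nat.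
  by apply: (le_trans b); rewrite ler_nat.
- by move=> n; exact: measurable_itv.
- by move=> n; exact: measurable_gamma_funE.
- by move=> n x _; rewrite lee_fin gamma_fun_ge0.
Qed.

Lemma gamma_int_ge0 s : (0 <= gamma_int s)%E.
Proof. by apply: integral_ge0 => x _; rewrite lee_fin gamma_fun_ge0. Qed.

(** Limit of [gamma_segment], whose boundary terms vanish. The identity is in the extended reals;
    finiteness of the integrals is deduced from it. *)
Lemma gamma_int_rec s : -1 < s ->
  gamma_int (s + 1) = ((s + 1)%:E * gamma_int s)%E.
Proof.
move=> s1; have s0 : 0 < s + 1 by lra.
have c1 := @gamma_int_cvg s; have c2 := @gamma_int_cvg (s + 1).
have c3 : (gamma_fun (s + 1) n.+2%:R^-1 - gamma_fun (s + 1) n.+2%:R)%:E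
    @[n --> \oo] --> 0%E.
  apply/cvg_EFin; first by near=> n.
  rewrite -[X in _ --> X](subrr 0); apply: cvgB.
    exact: gamma_fun_invn_cvg0.
  exact: gamma_fun_natr_cvg0.
have def0 : (0 +? (s + 1)%:E * gamma_int s)%E by rewrite fin_num_adde_defr.
have c4 := @cvgeD _ _ eventually_filter _ _ _ _ _ def0 c3
  (cvgeZl (y := (s + 1)%:E) isT c1).
rewrite add0e in c4.
have an n : 0 < n.+2%:R^-1 :> R by rewrite invr_gt0 ltr0n.
have ab n : n.+2%:R^-1 < n.+2%:R :> R.
  by apply: (@lt_trans _ _ 1); rewrite ?invf_lt1 ?ltr0n ?ltr1n.
have c5 : (\int[mu]_(x in `[(n.+2%:R^-1)%R, n.+2%:R%R])
    (gamma_fun (s + 1) x)%:E)%E @[n --> \oo] --> ((s + 1)%:E * gamma_int s)%E.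
  apply: cvg_trans c4; apply: near_eq_cvg; near=> n.
  by rewrite gamma_segment ?an ?ab.
exact: (cvg_unique _ c2 c5).
Unshelve. all: by end_near. Qed.

(** Comparison with the exponential density of rate 1. *)
Lemma gamma_int0_lty : (gamma_int 0 < +oo)%E.
Proof.
apply: (@le_lt_trans _ _ 1%E); last exact: ltry.
rewrite -(@integral_exponential_pdf R 1 ltr01) /gamma_int.
under eq_integral => x.
  rewrite inE/= in_itv/= andbT => x0.
  have -> : gamma_fun 0 x = exponential_pdf 1 x.
    by rewrite exponential_pdfE ?ltW// /gamma_fun powRr0 !mul1r mulN1r.
  over.
apply: ge0_subset_integral => //.
- by apply/measurable_EFinP; exact: measurable_exponential_pdf.
- by move=> x _; rewrite lee_fin exponential_pdf_ge0.
Qed.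

Lemma gamma_int_natr_lty (m : nat) : (gamma_int m%:R < +oo)%E.
Proof.
elim: m => [|m IH]; first exact: gamma_int0_lty.
rewrite -natr1 gamma_int_rec; last by apply: lt_le_trans (ler0n _ _); lra.
by apply: lte_mul_pinfty; rewrite ?lee_fin ?addr_ge0.
Qed.

(** For an integer m >= s one has x^s <= 1 + x^m on the half-line. *)
Lemma gamma_int_ge0_lty s : 0 <= s -> (gamma_int s < +oo)%E.
Proof.
move=> s0; pose m := (Num.truncn s).+1.
have sm : s <= m%:R by rewrite ltW// truncnS_gt.
apply: (@le_lt_trans _ _ (gamma_int 0 + gamma_int m%:R)%E); last first.
  by apply: lte_add_pinfty; [exact: gamma_int0_lty | exact: gamma_int_natr_lty].
rewrite /gamma_int -ge0_integralD//; first last.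
- exact: measurable_gamma_funE.
- by move=> x _; rewrite lee_fin gamma_fun_ge0.
- exact: measurable_gamma_funE.
- by move=> x _; rewrite lee_fin gamma_fun_ge0.
apply: ge0_le_integral => //.
- by move=> x _; rewrite lee_fin gamma_fun_ge0.
- exact: measurable_gamma_funE.
- by apply: emeasurable_funD; exact: measurable_gamma_funE.
move=> x /=; rewrite in_itv/= andbT => x0; rewrite -EFinD lee_fin.
rewrite /gamma_fun powRr0 mul1r -[X in X + _]mul1r -mulrDl.
rewrite ler_wpM2r ?expR_ge0//.
have [x1|x1] := leP x 1.
  apply: (@le_trans _ _ 1); last by rewrite lerDl powR_ge0.
  by rewrite -(powRr0 x) ger_powR// x0.
apply: (@le_trans _ _ (x `^ m%:R)); last by rewrite lerDr.
by rewrite ler_powR// ltW.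
Qed.

(** As s + 1 > 0, the recurrence would carry an infinite value at s to s + 1, where the integral is
    finite. *)
Lemma gamma_int_lty s : -1 < s -> (gamma_int s < +oo)%E.
Proof.
move=> s1; have s0 : 0 < s + 1 by lra.
have := gamma_int_ge0_lty (ltW s0); rewrite gamma_int_rec//.
have := gamma_int_ge0 s; case: (gamma_int s) => [r _ _|_|//].
  exact: ltry.
by rewrite gt0_muley ?lte_fin.
Qed.

Lemma gamma_int_gt0 s : -1 < s -> (0 < gamma_int s)%E.
Proof.
(* On [1, 2], x^s >= 1/x >= 1/2 and e^{-x} >= e^{-2}. *)
move=> s1; pose c : R := 2^-1 * expR (-2).
have c0 : 0 < c by rewrite mulr_gt0 ?invr_gt0 ?expR_gt0.
apply: (@lt_le_trans _ _ (\int[mu]_(x in `[1%R, 2%R]) c%:E)%E).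
  rewrite integral_cst//= lebesgue_measure_itv/= lte_fin ltr1n/=.
  by rewrite -EFinB -EFinM lte_fin mulr_gt0//; lra.
apply: (@le_trans _ _ (\int[mu]_(x in `[1%R, 2%R]) (gamma_fun s x)%:E)%E).
  apply: ge0_le_integral => //.
  - by move=> x _; rewrite lee_fin ltW.
  - exact: measurable_gamma_funE.
  move=> x /=; rewrite in_itv/= => /andP[x1 x2]; rewrite lee_fin.
  apply: ler_pM; rewrite ?invr_ge0 ?expR_ge0//.
    apply: (@le_trans _ _ (x `^ (-1))); last by rewrite ler_powR// ltW.
    by rewrite powR_inv1 ?lef_pV2 ?posrE//; lra.
  by rewrite ler_expR lerN2.
apply: ge0_subset_integral => //.
- exact: measurable_gamma_funE.
- by move=> x _; rewrite lee_fin gamma_fun_ge0.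
- move=> x /=; rewrite !in_itv/= andbT => /andP[x1 _].
  exact: lt_le_trans x1.
Qed.

Lemma gamma_int_fin_num s : -1 < s -> gamma_int s \is a fin_num.
Proof. by move=> s1; rewrite ge0_fin_numE ?gamma_int_ge0 ?gamma_int_lty. Qed.

Lemma integrable_gamma_fun s : -1 < s ->
  mu.-integrable `]0, +oo[ (EFin \o gamma_fun s).
Proof.
move=> s1; apply/integrableP; split; first exact: measurable_gamma_funE.
under eq_integral do rewrite gee0_abs ?lee_fin ?gamma_fun_ge0//.
exact: gamma_int_lty.
Qed.

(** * Mellin transforms of polynomials *)

(** At s > -1 this is Gamma(s + k + 1) / Gamma(s + 1). *)
Definition rising (k : nat) : {poly R} := \prod_(j < k) ('X + j.+1%:R%:P).

Lemma gamma_int_rising s (k : nat) : -1 < s ->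
  gamma_int (s + k%:R) = (((rising k).[s])%:E * gamma_int s)%E.
Proof.
move=> s1; elim: k => [|k IH].
  by rewrite addr0 /rising big_ord0 hornerC mul1e.
rewrite -natr1 addrA gamma_int_rec; last first.
  by apply: lt_le_trans s1 _; rewrite lerDl.
rewrite IH muleA -EFinM /rising big_ord_recr/= hornerM hornerD hornerX hornerC.
by rewrite mulrC -natr1 addrA.
Qed.

(** The Mellin transform of p e^{-x} at s + 1, divided by Gamma(s + 1); this quotient is a
    polynomial in s. *)
Definition mellin (p : {poly R}) : {poly R} :=
  \sum_(k < size p) p`_k *: rising k.

Lemma mellinE (p : {poly R}) N : (size p <= N)%N ->
  mellin p = \sum_(k < N) p`_k *: rising k.
Proof.
move=> pN; rewrite /mellin (big_ord_widen_cond N xpredT (fun k => p`_k *: rising k))//.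
rewrite big_mkcond/=; apply: eq_bigr => k _; case: ltnP => // kp.
by rewrite nth_default// scale0r.
Qed.

Lemma gamma_int_horner s (p : {poly R}) : -1 < s ->
  (\int[mu]_(x in `]0%R, +oo[) (p.[x] * x `^ s * expR (- x))%:E =
   ((mellin p).[s])%:E * gamma_int s)%E.
Proof.
move=> s1; have sk (k : nat) : -1 < s + k%:R.
  by apply: lt_le_trans s1 _; rewrite lerDl.
transitivity (\int[mu]_(x in `]0%R, +oo[)
   (\sum_(k < size p) (p`_k)%:E * (EFin \o gamma_fun (s + k%:R)) x))%E.
  apply: eq_integral => x; rewrite inE/= in_itv/= andbT => x0.
  under eq_bigr do rewrite /= -EFinM.
  rewrite sumEFin; congr (_%:E); rewrite horner_coef !mulr_suml.
  apply: eq_bigr => k _; rewrite /gamma_fun powRD ?(gt_eqF x0) ?implybT//.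
  by rewrite powR_mulrn ?ltW//; ring.
rewrite integral_sum//; last first.
  by move=> k; apply: integrableZl => //; exact: integrable_gamma_fun.
transitivity (\sum_(k < size p) ((p`_k)%:E * gamma_int (s + k%:R))%E).
  apply: eq_bigr => k _; rewrite integralZl//.
  exact: integrable_gamma_fun.
under eq_bigr do rewrite gamma_int_rising//.
rewrite -(fineK (gamma_int_fin_num s1)).
under eq_bigr do rewrite -!EFinM.
rewrite sumEFin -EFinM; congr (_%:E); rewrite /mellin horner_sum mulr_suml.
by apply: eq_bigr => k _; rewrite hornerZ mulrA.
Qed.

Lemma size_rising k : size (rising k) = k.+1 /\ rising k \is monic.
Proof.
have -> : rising k = \prod_(j <- enum 'I_k) ('X - (- j.+1%:R)%:P).
  rewrite big_enum; apply: eq_bigr => j _; by rewrite polyCN opprK.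
by rewrite size_prod_XsubC size_enum_ord monic_prod_XsubC.
Qed.

Lemma mellinD (p q : {poly R}) : mellin (p + q) = mellin p + mellin q.
Proof.
have := size_polyD p q; set N := maxn _ _ => pqN.
rewrite (mellinE pqN) (@mellinE p N) ?leq_maxl// (@mellinE q N) ?leq_maxr//.
by rewrite -big_split/=; apply: eq_bigr => k _; rewrite coefD scalerDl.
Qed.

Lemma mellinZ c (p : {poly R}) : mellin (c *: p) = c *: mellin p.
Proof.
rewrite (mellinE (size_scale_leq c p)) scaler_sumr; apply: eq_bigr => k _.
by rewrite coefZ scalerA.
Qed.

Lemma size_mellin_le (p : {poly R}) : (size (mellin p) <= size p)%N.
Proof.
apply: leq_trans (size_sum _ _ _) _; apply/bigmax_leqP => k _.
by apply: leq_trans (size_scale_leq _ _) _; rewrite (size_rising k).1.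
Qed.

(** [rising k] is monic of degree [k], so [mellin] preserves the leading coefficient. *)
Lemma mellin_inj0 (p : {poly R}) : mellin p = 0 -> p = 0.
Proof.
move=> mp0; apply/eqP; rewrite -lead_coef_eq0 /lead_coef.
case E : (size p) => [|m].
  by move/eqP: E; rewrite size_poly_eq0 => /eqP ->; rewrite coef0.
have : (mellin p)`_m = 0 by rewrite mp0 coef0.
rewrite (@mellinE p m.+1) ?E// big_ord_recr/= coefD coef_sum big1 ?add0r.
  have [sr /monicP] := size_rising m; rewrite /lead_coef sr/= => r1.
  by rewrite coefZ r1 mulr1 => ->.
move=> k _; rewrite coefZ [(rising k)`_m]nth_default ?mulr0// (size_rising k).1.
exact: ltn_ord.
Qed.

End GammaIntegral.

(** * Multiple Laguerre polynomials *)

Section MultipleLaguerre.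
Variable R : realType.
Implicit Types (p q : {poly R}) (b : R) (l : seq R).

Lemma mellinXn (k : nat) : mellin ('X^k : {poly R}) = rising R k.
Proof.
rewrite (@mellinE _ _ k.+1) ?size_polyXn// big_ord_recr/= coefXn eqxx scale1r.
rewrite big1 ?add0r// => j _; rewrite coefXn ltn_eqF ?scale0r//.
Qed.

Lemma mellin_sum (I : finType) (F : I -> {poly R}) :
  mellin (\sum_i F i) = \sum_i mellin (F i).
Proof.
apply: (big_morph _ (@mellinD R)).
by rewrite /mellin size_poly0 big_ord0.
Qed.

(** On a monomial, [raise b] gives x^{k+1} - (1 + b + k) x^k, while [rising] gains the factor X + k
    + 1; the difference is X - b. *)
Lemma mellin_raise b p : mellin (raise b p) = ('X - b%:P) * mellin p.
Proof.
have mono (k : nat) : mellin (raise b 'X^k) = ('X - b%:P) * mellin 'X^k.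
  have -> : raise b 'X^k = 'X^(k.+1) - (1 + b + k%:R) *: 'X^k.
    rewrite /raise derivXn exprS polyCD -mul_polyC !polyCD.
    case: k => [|k]; first by rewrite mulr0n polyC0; ring.
    by rewrite /= exprS -mulr_natr polyC_natr; ring.
  rewrite -scaleNr mellinD mellinZ !mellinXn scaleNr -mul_polyC.
  rewrite /rising big_ord_recr/= -natr1 !polyCD; ring.
rewrite -[in LHS](coefK p) poly_def raise_sum mellin_sum.
rewrite -[in RHS](coefK p) poly_def mellin_sum mulr_sumr.
by apply: eq_bigr => k _; rewrite raiseZ !mellinZ mono scalerAr.
Qed.

Lemma mellin_lag l : mellin (lag l) = \prod_(b <- l) ('X - b%:P).
Proof.
elim: l => [|b l IH] /=; last by rewrite mellin_raise IH big_cons.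
by rewrite big_nil -(expr0 'X) mellinXn /rising big_ord0.
Qed.

Variable r : nat.
Implicit Types (alpha : 'I_r -> R) (n : 'I_r -> nat) (i j : 'I_r).

(** * Identification with iterated raising operators *)

Definition params alpha n : seq R :=
  [seq alpha j + k%:R | j <- enum 'I_r, k <- iota 0 (n j)].

Lemma size_params alpha n : size (params alpha n) = (\sum_(j < r) n j)%N.
Proof.
rewrite size_allpairs_dep sumnE big_map big_enum /=.
by apply: eq_bigr => j _; rewrite size_iota.
Qed.

Lemma all_params alpha n : (forall j, -1 < alpha j) ->
  all (> -1) (params alpha n).
Proof.
move=> h; apply/allP => _ /allpairsPdep[j [k [_ _ ->]]].
by apply: lt_le_trans (h j) _; rewrite lerDl.
Qed.

Lemma uniq_params alpha n :
  (forall j k, j != k -> alpha j - alpha k \isn't a Num.int) ->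
  uniq (params alpha n).
Proof.
move=> h; apply: allpairs_uniq_dep => [|j _|]; rewrite ?enum_uniq ?iota_uniq//.
move=> [j k] [j' k'] _ _ /= E.
have jj' : j = j'.
  apply/eqP; apply: contraT => /h/negP[].
  have -> : alpha j - alpha j' = k'%:R - k%:R.
    by apply/eqP; rewrite subr_eq addrAC eq_sym subr_eq -addrC -E addrC.
  by rewrite rpredB// natr_int.
rewrite jj' in E *; congr existT.
by move/addrI/eqP: E; rewrite eqr_nat => /eqP.
Qed.

(** The moment with exponent b is the value of [mellin p] at b times Gamma(b + 1), which is
    positive. *)
Lemma is_mlaguerreP alpha n p : (forall j, -1 < alpha j) ->
  is_mlaguerre alpha n p <->
  [/\ p \is monic, size p = (\sum_(j < r) n j)%N.+1 &
      forall b, b \in params alpha n -> (mellin p).[b] = 0].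
Proof.
move=> h; split=> -[pm sp hp]; split=> //.
  move=> _ /allpairsPdep[j [k [_ + ->]]]; rewrite mem_iota => /andP[_ kn].
  have s1 : -1 < alpha j + k%:R by apply: lt_le_trans (h j) _; rewrite lerDl.
  move: (hp j k kn); rewrite gamma_int_horner//.
  move/eqP; rewrite mule_eq0 [X in _ || X]gt_eqF ?gamma_int_gt0// orbF.
  by rewrite eqe => /eqP.
move=> j k kn.
have s1 : -1 < alpha j + k%:R by apply: lt_le_trans (h j) _; rewrite lerDl.
rewrite gamma_int_horner// hp ?mul0e//.
by apply/allpairsPdep; exists j, k; rewrite mem_enum mem_iota.
Qed.

(** Existence follows from [mellin_lag]. For uniqueness, the difference of two candidates has a
    Mellin image of degree below |n| with |n| distinct zeros. *)
Lemma mlaguerre_lag alpha n : (forall j, -1 < alpha j) ->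
  (forall j k, j != k -> alpha j - alpha k \isn't a Num.int) ->
  mlaguerre alpha n = lag (params alpha n).
Proof.
move=> h hZ; have U := uniq_params n hZ.
have L : is_mlaguerre alpha n (lag (params alpha n)).
  apply/is_mlaguerreP => //; rewrite lag_monic size_lag size_params; split=> //.
  by move=> b bl; apply/rootP; rewrite mellin_lag root_prod_XsubC.
apply: xget_unique => //= p pL.
have /is_mlaguerreP-/(_ h)[Lm sL L0] := L.
have /is_mlaguerreP-/(_ h)[pm sp p0] := pL.
apply/eqP; rewrite -subr_eq0; apply/eqP/mellin_inj0.
apply: (roots_geq_poly_eq0 (rs := params alpha n)) => //.
  apply/allP => b bl; apply/rootP; rewrite -scaleN1r mellinD mellinZ.
  by rewrite !hornerE p0// L0// mulr0 addr0.
by rewrite size_params (leq_trans (size_mellin_le _))// size_monicB.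
Qed.

(** * The two interlacings *)

Definition params_off i alpha n : seq R :=
  [seq alpha j + k%:R | j <- rem i (enum 'I_r), k <- iota 0 (n j)].

Lemma perm_params i alpha n :
  perm_eq (params alpha n) (params_off i alpha n ++ arith (alpha i) (n i)).
Proof.
rewrite perm_sym perm_catC.
apply: (@perm_trans _ [seq alpha j + k%:R | j <- i :: rem i (enum 'I_r),
   k <- iota 0 (n j)]) => //.
by apply: perm_allpairs_dep => //; rewrite perm_sym perm_to_rem// mem_enum.
Qed.

Lemma eq_params_off i alpha n alpha' n' :
  (forall j, j != i -> alpha j = alpha' j) ->
  (forall j, j != i -> n j = n' j) ->
  params_off i alpha n = params_off i alpha' n'.
Proof.
move=> ea en; congr flatten; apply/eq_in_map => j.
by rewrite mem_rem_uniq ?enum_uniq// => /andP[/= ji _]; rewrite ea ?en.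
Qed.

Lemma zeros_of_rootpoly N (s : nat -> R) : increasing_upto N s ->
  zeros_of (rootpoly N s) (mkseq s N).
Proof.
move=> inc; split.
- exact/monic_neq0/rootpoly_monic.
- have := increasing_upto_sorted inc; apply: sub_sorted => x y; exact: ltW.
- by rewrite (monicP (rootpoly_monic _ _)) scale1r rootpolyE.
Qed.

Lemma arith_le (a b : R) (m : nat) : a <= b ->
  all2 <=%R (arith a m) (arith b m).
Proof.
by elim: m a b => // m IH a b ab; rewrite !arithS/= ab IH// lerD2r.
Qed.

Lemma mlaguerre_add_e i alpha n : (forall j, -1 < alpha j) ->
  (forall j k, j != k -> alpha j - alpha k \isn't a Num.int) ->
  mlaguerre alpha (add_e n i 1%N) ≼ mlaguerre alpha n.
Proof.
move=> h hZ; rewrite !mlaguerre_lag//.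
(* Increasing n_i adds the single parameter alpha_i + n_i. *)
have -> : lag (params alpha (add_e n i 1%N)) =
    raise (alpha i + (n i)%:R) (lag (params alpha n)).
  rewrite (lag_perm (perm_params i _ _)) (lag_perm (perm_params i alpha n)).
  rewrite (@eq_params_off i alpha (add_e n i 1%N) alpha n)//; last first.
    by move=> j /negPf ji; rewrite /add_e ji.
  rewrite /add_e eqxx [(n i + 1)%R]addn1 /arith mkseqS -cats1 catA.
  by rewrite lag_cat_cons cats0.
have [s [inc pos ->]] := lag_posroots (all_params n h).
set N := size _; have b1 : -1 < alpha i + (n i)%:R.
  by apply: lt_le_trans (h i) _; rewrite lerDl.
have [v sv ->] := raise_laced b1 inc pos.
exists (mkseq v N.+1), (mkseq s N); split; try exact: zeros_of_rootpoly.
  exact/zeros_of_rootpoly/(laced_inc_r sv).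
right; rewrite !size_mkseq; split=> // k kN.
rewrite !nth_mkseq ?ltnS ?(ltnW kN)//.
(* [s k] is the entry of index [k.+1] of [cons0 s]. *)
by case: sv => sv vs; rewrite (ltW (vs k _))//= (ltW (sv k.+1 _)).
Qed.

(** The zeros w for the shift t lie between the zeros v and v' for the shifts 0 and 2, and v'_k <
    v_{k+1}. *)
Lemma mlaguerre_shift i alpha n (t : R) : (0 < n i)%N -> 0 <= t <= 2 ->
  (forall j, -1 < alpha j) ->
  (forall j k, j != k -> alpha j - alpha k \isn't a Num.int) ->
  (forall j, j != i -> alpha i - alpha j + t \isn't a Num.int) ->
  mlaguerre alpha n ≼ mlaguerre (add_e alpha i t) n.
Proof.
move=> n0 /andP[t0 t2] h hZ htZ.
have h' j : -1 < add_e alpha i t j.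
  by rewrite /add_e; case: eqP => // _; rewrite (lt_le_trans (h j))// lerDl.
have hZ' j k : j != k ->
    add_e alpha i t j - add_e alpha i t k \isn't a Num.int.
  rewrite /add_e; case: (eqVneq j i) => [->|ji]; case: (eqVneq k i) => [->|ki].
  - by [].
  - by move=> _; rewrite addrAC htZ.
  - by move=> _; rewrite -rpredN opprB addrAC htZ.
  - exact: hZ.
rewrite !mlaguerre_lag//.
rewrite (lag_perm (perm_params i alpha n)).
rewrite (lag_perm (perm_params i (add_e alpha i t) n)).
rewrite (@eq_params_off i (add_e alpha i t) n alpha n)//; last first.
  by move=> j /negPf ji; rewrite /add_e ji.
rewrite /add_e eqxx.
have Aoff : all (> -1) (params_off i alpha n).
  by have := all_params n h; rewrite (perm_all _ (perm_params i alpha n)) all_cat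
    => /andP[].
have arith_gt (a : R) m : -1 < a -> all (> -1) (arith a m).
  move=> a1; apply/allP => _ /mapP[k _ ->].
  by apply: lt_le_trans a1 _; rewrite lerDl.
(* The positive n_i is written [m.+1], the form that [lag_laced] takes. *)
move: (alpha i) (h i) (n i) n0 (params_off i alpha n) Aoff => a a1 [//|m] _ off Aoff.
have A0 : all (> -1) (off ++ arith a m.+1) by rewrite all_cat Aoff arith_gt.
have at1 : -1 < a + t by rewrite (lt_le_trans a1)// lerDl.
have A1 : all (> -1) (off ++ arith (a + t) m.+1) by rewrite all_cat Aoff arith_gt.
have [s sP] := lag_posroots (arith_gt a m.+1 a1).
rewrite size_mkseq in sP.
have [u su Eu] := lag_arith_laced a1 sP.
have [v [v' [vP vv' E']]] := lag_laced Aoff sP su Eu.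
rewrite -!foldr_cat -/(lag _) in vP E'.
set N := (size off + m.+1)%N in vP vv' E'.
have szN b : size (off ++ arith b m.+1) = N by rewrite size_cat size_mkseq.
have v'P : posroots N v' (lag (off ++ arith (a + 2) m.+1)).
  split=> //; first exact: laced_inc_r vv'.
  by apply: laced_positive vv'; case: vP.
have [w wP] := lag_posroots A1; rewrite szN in wP.
have vw : forall k, (k < N)%N -> v k <= w k.
  apply: (lag_monotone A0 _ vP wP); last by rewrite szN.
  by apply: arith_le; rewrite lerDl.
have wv' : forall k, (k < N)%N -> w k <= v' k.
  apply: (lag_monotone A1 _ wP v'P); last by rewrite szN.
  by apply: arith_le; rewrite lerD2l.
case: vP => incv _ ->; case: wP => incw _ ->.
exists (mkseq v N), (mkseq w N); split; try exact: zeros_of_rootpoly.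
left; rewrite !size_mkseq; split=> // k kN.
  by rewrite !nth_mkseq// vw.
rewrite !nth_mkseq ?(ltnW kN)//; apply: le_trans (wv' _ (ltnW kN)) _.
by apply: ltW; case: vv' => _; exact.
Qed.

End MultipleLaguerre.

Theorem theorem5p7 (R : realType) (r : nat) (n : 'I_r -> nat)
    (alpha : 'I_r -> R)
    (hn : forall j, (0 < n j)%N)
    (halpha : forall j, -1 < alpha j)
    (halphaZ : forall j k, j != k -> alpha j - alpha k \isn't a Num.int)
    (i : 'I_r) (t : R) (ht : 0 <= t <= 2)
    (htZ : forall j, j != i -> alpha i - alpha j + t \isn't a Num.int) :
  mlaguerre alpha (add_e n i 1%N) ≼ mlaguerre alpha n /\
  mlaguerre alpha n ≼ mlaguerre (add_e alpha i t) n.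
Proof. by split; [exact: mlaguerre_add_e | exact: mlaguerre_shift]. Qed.
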